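(* Let $R$ be a finite set of slopes containing $0,1,\infty$, and let $s$ be a slope not in $R$. Then $$\mathrm{SD}(R;s)\le 2-\frac{c}{f(R;s)}$$ for some absolute constant $c>0$ (with the right-hand side interpreted as $2$ if $f(R;s)=+\infty$).
   Context: A slope is an element of $\mathbb{Q}\cup\{\infty\}$; $\pi_r(x,y)=x+ry$ for $r\ne\infty$, $\pi_\infty(x,y)=y$. Random variables take finitely many values; $\mathbf{H}[X]=\sum_x\mathbf{P}(X=x)\log\frac1{\mathbf{P}(X=x)}$. $\mathrm{SD}(R;s)$ is the least exponent such that $\mathbf{H}[\pi_s(X,Y)]\le\mathrm{SD}(R;s)\max_{r\in R}\mathbf{H}[\pi_r(X,Y)]$ for all $\mathbb{Q}$-valued random variables $X,Y$ (not necessarily independent). The independent sum-difference constant $f(R;s)$ is the least constant (or $+\infty$ if none exists) such that: whenever $X,Y$ are independent $\mathbb{Q}$-valued random variables and $M\ge0$, $K\ge1$ satisfy $M-\log K\le\mathbf{H}[\pi_r(X,Y)]\le M+\log K$ for all $r\in R$, then $\mathbf{H}[\pi_s(X,Y)]\le M+f(R;s)\log K$. *)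

(* Defs.v *)
From HB Require Import structures.
From mathcomp Require Export all_boot all_order all_algebra finmap.
From mathcomp Require Export all_classical all_reals all_analysis.

Set Implicit Arguments.
Unset Strict Implicit.
Unset Printing Implicit Defensive.

Import Order.TTheory GRing.Theory Num.Theory.

Local Open Scope classical_set_scope.
Local Open Scope ring_scope.

(* [Some r] is the rational slope r, [None] is the slope infinity. *)
Definition slope : choiceType := option rat.
Definition slope_of (r : rat) : slope := Some r.
Definition slope_infty : slope := None.

Definition slope_proj (r : slope) (x y : rat) : rat :=
  if r is Some q then x + q * y else y.

Section Probability.
Context (R : realType) (d : measure_display) (T : measurableType d).
Implicit Types (P : probability T R) (X Y : T -> rat).

(* For a map with finite range, measurability for the discrete sigma-algebra
   of rat amounts to measurability of the fibers. *)
Definition finite_rv X : Prop :=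
  finite_set (range X) /\ (forall q : rat, measurable (X @^-1` [set q])).

(* Terms with p = 0 contribute 0, since p is a factor.
   The sum over [range X] is the usual one when X has finite range. *)
Definition entropy P X : R :=
  \sum_(q \in range X)
    (let p := fine (P (X @^-1` [set q])) in p * ln (1 / p)).

(* For finitely valued variables this is independence of the generated
   sigma-algebras. *)
Definition independent_rv P X Y : Prop :=
  forall a b : rat,
    P (X @^-1` [set a] `&` Y @^-1` [set b])
    = (P (X @^-1` [set a]) * P (Y @^-1` [set b]))%E.

Definition proj_rv (r : slope) X Y : T -> rat :=
  fun w => slope_proj r (X w) (Y w).

End Probability.

(* Entropies are nonnegative, so the default value 0 of the maximum is
   harmless as soon as S is nonempty. *)
Definition SD_admissible (R : realType) (S : {fset slope}) (s : slope)
    (t : R) : Prop :=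
  forall (d : measure_display) (T : measurableType d) (P : probability T R)
         (X Y : T -> rat),
    finite_rv X -> finite_rv Y ->
    entropy P (proj_rv s X Y)
    <= t * \big[Num.max/0]_(r <- S) entropy P (proj_rv r X Y).

Definition indep_admissible (R : realType) (S : {fset slope}) (s : slope)
    (t : R) : Prop :=
  forall (d : measure_display) (T : measurableType d) (P : probability T R)
         (X Y : T -> rat) (M K : R),
    finite_rv X -> finite_rv Y -> independent_rv P X Y ->
    0 <= M -> 1 <= K ->
    (forall r : slope, r \in S ->
       M - ln K <= entropy P (proj_rv r X Y) <= M + ln K) ->
    entropy P (proj_rv s X Y) <= M + t * ln K.

(* The admissible constants form a closed set of reals, so a finite infimum
   is attained; the infimum of the empty set is +oo. *)
Definition SD (R : realType) (S : {fset slope}) (s : slope) : \bar R :=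
  ereal_inf [set t%:E | t in @SD_admissible R S s].

Definition indep_sum_diff (R : realType) (S : {fset slope}) (s : slope)
    : \bar R :=
  ereal_inf [set t%:E | t in @indep_admissible R S s].

(* Main.v *)
From HB Require Import structures.
Require Import Defs.
From mathcomp Require Import ring lra.

(* Let M be the maximum of H[x + r y] over r in R and put D = 2M - H[x + s y].
   If D is small compared with M, then X and Y are nearly independent. Take a path
   x1 - y1 - x2 - y2 - x3 - y3 of copies of (X, Y), with consecutive edges
   conditionally independent given their common vertex; its joint entropy is
   at least 6M - 5D. Since x1 + r y3 is an alternating sum of the five edge
   sums, submodularity gives H[x1 + r y3] <= M + 5D, simultaneously for all r,
   and x1, y3 are independent given y1. Entropies add up under
   (X, Y), (X', Y') |-> (X + l X', Y + l Y') for independent pairs and generic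
   l, so taking many copies shows that the constant f also controls
   conditional entropies: H[x1 + s y3 | y1] <= M + 5 f D. Finally, slope 1 makes
   the entropies of x1 - x2 and y3 - y2 about M. The variable x2 + s y2, of
   entropy about 2M, is a function of x1 + s y3 and the pair
   (x1 - x2, y3 - y2), and this pair, of entropy about 2M, is nearly independent
   of it. Hence 2M <= M + O(f D). *)

Set Implicit Arguments.
Unset Strict Implicit.
Unset Printing Implicit Defensive.

Import Order.TTheory GRing.Theory Num.Theory.

(** * Entropy and submodularity on finite spaces *)

Section FiniteEntropy.
Context (R : realType).
Local Open Scope ring_scope.

Record fdist (O : finType) := FDist {
  mass :> O -> R;
  mass_ge0 : forall w, 0 <= mass w;
  mass_sum1 : \sum_w mass w = 1 }.
Arguments mass : simpl never.

Definition prob (O : finType) (A : eqType) (p : fdist O) (f : O -> A) (a : A) : R :=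
  \sum_(w | f w == a) p w.

(** The mean of the information content over atoms, not a sum over values, so that entropies of
    different variables compare atom by atom. *)
Definition entr (O : finType) (A : eqType) (p : fdist O) (f : O -> A) : R :=
  \sum_w p w * - ln (prob p f (f w)).

(* Only atoms of positive mass count, so that almost sure constraints such as
   [glue_eq] below may be used. *)
Definition determines (O : finType) (A B : eqType) (p : fdist O)
    (g : O -> A) (f : O -> B) : Prop :=
  forall w v, 0 < p w -> 0 < p v -> g w = g v -> f w = f v.

Section Basics.
Context (O : finType) (p : fdist O).
Implicit Types (A B C D : eqType).

Lemma mass_gt0 w : p w != 0 -> 0 < p w.
Proof. by move=> pw; rewrite lt_neqAle eq_sym pw mass_ge0. Qed.

Lemma prob_ge0 A (f : O -> A) a : 0 <= prob p f a.
Proof. by apply: sumr_ge0 => w _; exact: mass_ge0. Qed.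

Lemma mass_le_prob A (f : O -> A) w : p w <= prob p f (f w).
Proof.
rewrite /prob (bigD1 w) //= lerDl; apply: sumr_ge0 => v _; exact: mass_ge0.
Qed.

Lemma prob_gt0 A (f : O -> A) w : 0 < p w -> 0 < prob p f (f w).
Proof. by move=> pw; apply: lt_le_trans pw (mass_le_prob f w). Qed.

Lemma prob_le1 A (f : O -> A) a : prob p f a <= 1.
Proof.
rewrite -(mass_sum1 p) /prob big_mkcond; apply: ler_sum => w _.
by case: ifP => // _; exact: mass_ge0.
Qed.

Lemma ler_prob A B (f : O -> A) (g : O -> B) a b :
  (forall w, 0 < p w -> g w = b -> f w = a) -> prob p g b <= prob p f a.
Proof.
move=> H; rewrite /prob [leLHS]big_mkcond [leRHS]big_mkcond.
apply: ler_sum => w _; case: (eqVneq (p w) 0) => [->|/mass_gt0 pw].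
  by do 2 case: ifP.
case: eqP => [/(H _ pw) ->|_]; first by rewrite eqxx.
by case: ifP => // _; exact: ltW.
Qed.

Lemma entr_ge0 A (f : O -> A) : 0 <= entr p f.
Proof.
apply: sumr_ge0 => w _; apply: mulr_ge0; first exact: mass_ge0.
rewrite oppr_ge0; apply: ln_le0; exact: prob_le1.
Qed.

Lemma entr_mono A B (f : O -> A) (g : O -> B) :
  determines p g f -> entr p f <= entr p g.
Proof.
move=> H; apply: ler_sum => w _.
case: (eqVneq (p w) 0) => [->|/mass_gt0 pw]; first by rewrite !mul0r.
apply: ler_wpM2l; first exact: mass_ge0.
rewrite lerN2 ler_ln ?posrE ?prob_gt0 //.
by apply: ler_prob => v pv gv; apply: H.
Qed.

Lemma entr_eq A B (f : O -> A) (g : O -> B) :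
  determines p g f -> determines p f g -> entr p f = entr p g.
Proof. by move=> *; apply/eqP; rewrite eq_le !entr_mono. Qed.

Lemma entr_cst A (a : A) : entr p (fun=> a) = 0.
Proof.
rewrite /entr big1 // => w _.
by rewrite /prob eqxx mass_sum1 ln1 oppr0 mulr0.
Qed.

(* Expanding [prob p f] and [prob p g] gives a sum over pairs [w1, w2], where
   only those with [k w1 = k w2] contribute. *)
Lemma submod_ratio_le1 A B C (f : O -> A) (g : O -> B) (k : O -> C) :
  determines p f k -> determines p g k ->
  \sum_w p w * (prob p f (f w) * prob p g (g w) /
    (prob p (fun v => (f v, g v)) (f w, g w) * prob p k (k w))) <= 1.
Proof.
move=> fk gk; set fg := (fun v => (f v, g v)).
pose c w := p w / (prob p fg (fg w) * prob p k (k w)).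
have -> : \sum_w p w * (prob p f (f w) * prob p g (g w) /
    (prob p fg (f w, g w) * prob p k (k w))) =
  \sum_w1 \sum_w2 p w1 * p w2 *
     \sum_(w | (f w == f w1) && (g w == g w2)) c w.
  transitivity (\sum_w \sum_w1 \sum_w2
     if (f w == f w1) && (g w == g w2) then p w1 * p w2 * c w else 0).
    apply: eq_bigr => w _.
    transitivity (prob p f (f w) * prob p g (g w) * c w).
      by rewrite /c /fg; ring.
    rewrite /prob [\sum_(_ | f _ == _) _]big_mkcond
      [\sum_(_ | g _ == _) _]big_mkcond /= !mulr_suml.
    apply: eq_bigr => w1 _; rewrite mulr_sumr mulr_suml; apply: eq_bigr => w2 _.
    rewrite (eq_sym (f w1)) (eq_sym (g w2)).
    by case: ifP; case: ifP => //=; rewrite ?(mul0r, mulr0).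
  rewrite exchange_big; apply: eq_bigr => w1 _.
  rewrite exchange_big; apply: eq_bigr => w2 _.
  by rewrite mulr_sumr [RHS]big_mkcond.
have le1 w1 w2 : p w1 * p w2 *
     \sum_(w | (f w == f w1) && (g w == g w2)) c w <=
   p w1 / prob p k (k w1) * (if k w2 == k w1 then p w2 else 0).
  case: (eqVneq (p w1) 0) => [->|/mass_gt0 p1]; first by rewrite !mul0r.
  case: (eqVneq (p w2) 0) => [->|/mass_gt0 p2].
    by rewrite !(mulr0, mul0r) if_same mulr0.
  case: eqP => k12; last first.
    rewrite big1 ?mulr0 // => w /andP[/eqP fw /eqP gw].
    case: (eqVneq (p w) 0) => [pw0|/mass_gt0 pw]; first by rewrite /c pw0 mul0r.
    by case: k12; rewrite -(fk _ _ pw p1 fw) (gk _ _ pw p2 gw).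
  (* With equal [k]-values, [c] runs over a single fibre of [fg], on which its denominator is
     constant and contains the mass of that fibre. *)
  suff: \sum_(w | (f w == f w1) && (g w == g w2)) c w <= (prob p k (k w1))^-1.
    move=> H; rewrite [leRHS](_ : _ = p w1 * p w2 * (prob p k (k w1))^-1).
      by apply: ler_wpM2l => //; rewrite mulr_ge0 ?mass_ge0.
    by ring.
  have E w : (f w == f w1) && (g w == g w2) ->
      c w = p w / prob p fg (f w1, g w2) / prob p k (k w1).
    case: (eqVneq (p w) 0) => [pw0|/mass_gt0 pw]; first by rewrite /c pw0 !mul0r.
    move=> /andP[/eqP fw /eqP gw].
    by rewrite /c /fg fw gw (fk _ _ pw p1 fw) invfM mulrA.
  rewrite (eq_bigr _ E) -mulr_suml -mulr_suml.
  rewrite ler_piMl ?invr_ge0 ?prob_ge0 //.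
  rewrite (_ : \sum_(_ | _) _ = prob p fg (f w1, g w2)) //.
  case: (eqVneq (prob p fg (f w1, g w2)) 0) => [->|nz]; first by rewrite mul0r.
  by rewrite divff.
apply: (@le_trans _ _ (\sum_w1 p w1)); last by rewrite mass_sum1.
apply: ler_sum => w1 _; apply: (le_trans (ler_sum _ (fun w2 _ => le1 w1 w2))).
rewrite -mulr_sumr -big_mkcond /= -/(prob p k (k w1)).
case: (eqVneq (p w1) 0) => [->|/mass_gt0 p1]; first by rewrite !mul0r.
by rewrite divfK // gt_eqF // prob_gt0.
Qed.

(** Monotonicity reduces [u] to the pair [(f, g)]. For the pair, [ln x <= x - 1] is applied to the
    ratio of [submod_ratio_le1], whose mean is at most 1. *)
Lemma entr_submod A B C D (f : O -> A) (g : O -> B) (k : O -> C) (u : O -> D) :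
  determines p f k -> determines p g k ->
  determines p (fun w => (f w, g w)) u ->
  entr p u + entr p k <= entr p f + entr p g.
Proof.
move=> fk gk fgu; have := entr_mono fgu; set fg := (fun w => (f w, g w)) => ufg.
suff: entr p fg + entr p k <= entr p f + entr p g by lra.
have H := submod_ratio_le1 fk gk.
rewrite -subr_le0 /entr -!big_split -sumrB /=.
suff: \sum_w p w * (prob p f (f w) * prob p g (g w) /
    (prob p fg (fg w) * prob p k (k w)) - 1) <= 0.
  apply: le_trans; apply: ler_sum => w _.
  case: (eqVneq (p w) 0) => [->|/mass_gt0 pw]; first by rewrite !mul0r !addr0 oppr0.
  have pf := prob_gt0 f pw; have pg := prob_gt0 g pw.
  have pfg := prob_gt0 fg pw; have pk := prob_gt0 k pw.
  rewrite -!mulrDr -mulrBr; apply: ler_wpM2l; first exact: ltW.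
  set x := (X in _ <= X - 1).
  have x0 : 0 < x by rewrite divr_gt0 ?mulr_gt0.
  have -> : - ln (prob p fg (fg w)) - ln (prob p k (k w)) -
      (- ln (prob p f (f w)) - ln (prob p g (g w))) = ln (1 + (x - 1)).
    rewrite (addrC 1) subrK ln_div ?lnM ?posrE ?mulr_gt0 //; ring.
  by apply: le_ln1Dx; lra.
rewrite (eq_bigr _ (fun w _ => mulrBr _ _ _)) sumrB.
rewrite (eq_bigr p (fun w _ => mulr1 _)) mass_sum1; lra.
Qed.

End Basics.
End FiniteEntropy.

(** * Couplings and conditioning *)

Section Couplings.
Context (R : realType).
Local Open Scope ring_scope.

Lemma sum_pair (O1 O2 : finType) (F : O1 * O2 -> R) :
  \sum_w F w = \sum_a \sum_b F (a, b).
Proof. by rewrite pair_bigA; apply: eq_bigr => -[]. Qed.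

Lemma probE (O : finType) (A : eqType) (p : fdist R O) (f : O -> A) a :
  prob p f a = \sum_w p w * (f w == a)%:R.
Proof.
rewrite /prob big_mkcond; apply: eq_bigr => w _.
by case: eqP; rewrite ?mulr1 ?mulr0.
Qed.

Lemma prob_id (O : finType) (p : fdist R O) w : prob p id w = p w.
Proof. by rewrite /prob big_pred1_eq. Qed.

(** A relation instead of a push-forward construction: the marginals of a coupling are distributions
    given beforehand. *)
Definition is_image (O O' : finType) (p : fdist R O) (phi : O -> O')
    (q : fdist R O') : Prop := forall v, prob p phi v = q v.

Section Image.
Context (O O' : finType) (p : fdist R O) (phi : O -> O') (q : fdist R O').
Hypothesis im : is_image p phi q.

Lemma image_sum (F : O' -> R) : \sum_w p w * F (phi w) = \sum_v q v * F v.
Proof.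
rewrite (partition_big phi xpredT) //=; apply: eq_bigr => v _.
by rewrite -im /prob mulr_suml; apply: eq_bigr => w /eqP ->.
Qed.

Lemma image_prob (A : eqType) (f : O' -> A) a :
  prob p (fun w => f (phi w)) a = prob q f a.
Proof. by rewrite !probE -image_sum. Qed.

Lemma image_entr (A : eqType) (f : O' -> A) :
  entr p (fun w => f (phi w)) = entr q f.
Proof.
by rewrite /entr -image_sum; apply: eq_bigr => w _; rewrite image_prob.
Qed.

Lemma image_gt0 w : 0 < p w -> 0 < q (phi w).
Proof. by move=> pw; rewrite -im; apply: prob_gt0. Qed.

End Image.

Section Glue.
Context (O1 O2 : finType) (A : eqType) (p1 : fdist R O1) (p2 : fdist R O2).
Context (k1 : O1 -> A) (k2 : O2 -> A).
Hypothesis same : forall a, prob p1 k1 a = prob p2 k2 a.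

Let mass12 (w : O1 * O2) : R :=
  if k1 w.1 == k2 w.2 then p1 w.1 * p2 w.2 / prob p1 k1 (k1 w.1) else 0.

Let mass12_fst w1 : \sum_w2 mass12 (w1, w2) = p1 w1.
Proof.
rewrite -big_mkcond /=.
case: (eqVneq (p1 w1) 0) => [->|/mass_gt0 p1_gt0].
  by rewrite big1 // => i _; rewrite !mul0r.
rewrite -mulr_suml -mulr_sumr.
under eq_bigl do rewrite eq_sym.
by rewrite -/(prob p2 k2 (k1 w1)) -same mulfK // gt_eqF // prob_gt0.
Qed.

Let mass12_snd w2 : \sum_w1 mass12 (w1, w2) = p2 w2.
Proof.
rewrite -big_mkcond /=.
case: (eqVneq (p2 w2) 0) => [->|/mass_gt0 p2_gt0].
  by rewrite big1 // => i _; rewrite mulr0 !mul0r.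
rewrite (eq_bigr (fun w1 => p1 w1 * (p2 w2 / prob p1 k1 (k2 w2)))); last first.
  by move=> w1 /eqP ->; rewrite mulrA.
rewrite -mulr_suml -/(prob p1 k1 (k2 w2)) mulrCA divff ?mulr1 //.
by rewrite same gt_eqF // prob_gt0.
Qed.

Let mass12_ge0 w : 0 <= mass12 w.
Proof.
rewrite /mass12; case: ifP => // _.
by rewrite divr_ge0 ?mulr_ge0 ?mass_ge0 ?prob_ge0.
Qed.

Let mass12_sum1 : \sum_w mass12 w = 1.
Proof.
by rewrite sum_pair (eq_bigr _ (fun w _ => mass12_fst w)) mass_sum1.
Qed.

(* The coupling of [p1] and [p2] with [k1 = k2] almost surely, conditionally
   independent given this common value. *)
Definition glue : fdist R (O1 * O2)%type := FDist mass12_ge0 mass12_sum1.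

Lemma glueE w : glue w =
  if k1 w.1 == k2 w.2 then p1 w.1 * p2 w.2 / prob p1 k1 (k1 w.1) else 0.
Proof. by []. Qed.

Lemma glue_fst : is_image glue fst p1.
Proof.
move=> v; rewrite /prob big_mkcond sum_pair (bigD1 v) //= [X in _ + X]big1 ?addr0.
  by under eq_bigr do rewrite eqxx; exact: mass12_fst.
by move=> w /negPf wv; rewrite big1 // => w2 _; rewrite wv.
Qed.

Lemma glue_snd : is_image glue snd p2.
Proof.
move=> v; rewrite /prob big_mkcond sum_pair exchange_big (bigD1 v) //=.
rewrite [X in _ + X]big1 ?addr0.
  by under eq_bigr do rewrite eqxx; exact: mass12_snd.
by move=> w /negPf wv; rewrite big1 // => w2 _; rewrite wv.
Qed.

Lemma glue_eq w : 0 < glue w -> k1 w.1 = k2 w.2.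
Proof. by rewrite glueE; case: eqP => // _; rewrite ltxx. Qed.

(** On an atom of positive mass, the logarithm of the mass splits into those of [p1] and [p2], minus
    that of the shared value, which is counted once. *)
Lemma glue_entr : entr glue id = entr p1 id + entr p2 id - entr p1 k1.
Proof.
rewrite -(image_entr glue_fst id) -(image_entr glue_snd id) -(image_entr glue_fst k1).
rewrite /entr -big_split -sumrB /=; apply: eq_bigr => w _.
rewrite -[mass12 w]/(glue w).
case: (eqVneq (glue w) 0) => [->|/mass_gt0 gw]; first by rewrite !mul0r addr0 subr0.
have H1 := image_gt0 glue_fst gw; have H2 := image_gt0 glue_snd gw.
rewrite -mulrDr -mulrBr; congr (_ * _).
rewrite !prob_id (image_prob glue_fst id) (image_prob glue_snd id)
  (image_prob glue_fst k1).
rewrite !prob_id glueE glue_eq // eqxx -glue_eq //.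
have H3 := prob_gt0 k1 H1.
rewrite ln_div ?lnM ?posrE ?mulr_gt0 //; ring.
Qed.

End Glue.

Section Cond.
Context (O : finType) (A : eqType) (p : fdist R O) (k : O -> A) (a : A).

Let massc (w : O) : R := if prob p k a == 0 then p w
  else if k w == a then p w / prob p k a else 0.

Let massc_ge0 w : 0 <= massc w.
Proof.
rewrite /massc; case: ifP => _; first exact: mass_ge0.
case: ifP => // _.
by rewrite divr_ge0 ?mass_ge0 ?prob_ge0.
Qed.

Let massc_sum1 : \sum_w massc w = 1.
Proof.
rewrite /massc; case: eqP => [_|/eqP nz]; first exact: mass_sum1.
by rewrite -big_mkcond /= -mulr_suml divff.
Qed.

(* Junk value [p] when the conditioning event is null. *)
Definition cond : fdist R O := FDist massc_ge0 massc_sum1.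

Lemma condE w : prob p k a != 0 ->
  cond w = if k w == a then p w / prob p k a else 0.
Proof. by rewrite /cond /mass /massc => /negPf ->. Qed.

Lemma cond_prob (B : eqType) (f : O -> B) b : prob p k a != 0 ->
  prob cond f b = prob p (fun w => (f w, k w)) (b, a) / prob p k a.
Proof.
move=> nz; rewrite [LHS]probE [prob p (fun _ => _) _]probE mulr_suml.
apply: eq_bigr => w _.
rewrite condE // xpair_eqE; case: (k w == a); case: (f w == b) => /=;
by rewrite ?(mulr0, mul0r, mulr1).
Qed.

End Cond.

(** The chain rule. After exchanging the double sum over [w] and [v] with equal [k]-values, the
    weights [p w / prob p k (k v)] sum to 1 over [w]. *)
Lemma cond_entr (O : finType) (A B : eqType) (p : fdist R O) (k : O -> A)
    (f : O -> B) :
  \sum_w p w * entr (cond p k (k w)) f =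
  entr p (fun w => (f w, k w)) - entr p k.
Proof.
set fk := (fun w => (f w, k w)).
pose F v := - (ln (prob p fk (fk v)) - ln (prob p k (k v))).
transitivity (\sum_w \sum_(v | k v == k w) p v * F v * (p w / prob p k (k v))).
  apply: eq_bigr => w _.
  case: (eqVneq (p w) 0) => [->|/mass_gt0 pw].
    by rewrite mul0r big1 // => v _; rewrite mul0r mulr0.
  have nz : prob p k (k w) != 0 by rewrite gt_eqF // prob_gt0.
  rewrite /entr mulr_sumr [RHS]big_mkcond; apply: eq_bigr => v _.
  rewrite condE // cond_prob //; case: eqP => [kvw|_]; last by rewrite mul0r mulr0.
  case: (eqVneq (p v) 0) => [->|/mass_gt0 pv]; first by rewrite !(mul0r, mulr0).
  have := prob_gt0 fk pv; have := prob_gt0 k pv.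
  rewrite /F /fk kvw => H1 H2.
  by rewrite ln_div ?posrE //; ring.
rewrite (exchange_big_dep xpredT) //= -sumrB; apply: eq_bigr => v _.
rewrite -mulr_sumr -mulr_suml.
under eq_bigl do rewrite eq_sym.
rewrite -/(prob p k (k v)) /F.
case: (eqVneq (p v) 0) => [->|/mass_gt0 pv]; first by rewrite !mul0r subr0.
by rewrite divff ?mulr1 ?gt_eqF ?prob_gt0 //; ring.
Qed.

Definition indep (O : finType) (A B : eqType) (p : fdist R O)
    (X : O -> A) (Y : O -> B) : Prop :=
  forall a b, prob p (fun w => (X w, Y w)) (a, b) = prob p X a * prob p Y b.

Lemma indep_product_mass (O1 O2 : finType) (A B : eqType)
    (q : fdist R (O1 * O2)%type) (q1 : fdist R O1) (q2 : fdist R O2)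
    (X : O1 -> A) (Y : O2 -> B) :
  (forall w, q w = q1 w.1 * q2 w.2) ->
  indep q (fun w => X w.1) (fun w => Y w.2).
Proof.
move=> qE.
have E (F : O1 -> R) (G : O2 -> R) :
    \sum_w q w * (F w.1 * G w.2) = (\sum_w q1 w * F w) * (\sum_w q2 w * G w).
  rewrite sum_pair mulr_suml; apply: eq_bigr => w1 _.
  by rewrite mulr_sumr; apply: eq_bigr => w2 _; rewrite qE /=; ring.
have s1 (O : finType) (r : fdist R O) : \sum_w r w * 1 = 1.
  by under eq_bigr do rewrite mulr1; exact: mass_sum1.
move=> a b.
have -> : prob q (fun w => X w.1) a = prob q1 X a.
  rewrite !probE; have /= := E (fun w => (X w == a)%:R) (fun=> 1).
  rewrite s1 mulr1 => <-.
  by apply: eq_bigr => w _; rewrite mulr1.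
have -> : prob q (fun w => Y w.2) b = prob q2 Y b.
  rewrite !probE; have /= := E (fun=> 1) (fun w => (Y w == b)%:R).
  rewrite s1 mul1r => <-.
  by apply: eq_bigr => w _; rewrite mul1r.
have /= := E (fun w => (X w == a)%:R) (fun w => (Y w == b)%:R).
rewrite !probE => <-; apply: eq_bigr => w _.
by rewrite xpair_eqE -natrM mulnb.
Qed.

(** Conditioned on the common value [a], the glued mass is the product of the two conditioned
    masses. *)
Lemma glue_cond_indep (O1 O2 : finType) (A B C : eqType) (p1 : fdist R O1)
    (p2 : fdist R O2) (k1 : O1 -> A) (k2 : O2 -> A)
    (same : forall a, prob p1 k1 a = prob p2 k2 a) (X : O1 -> B) (Y : O2 -> C) a :
  prob p1 k1 a != 0 ->
  indep (cond (glue same) (fun w => k1 w.1) a) (fun w => X w.1) (fun w => Y w.2).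
Proof.
move=> nz; apply: (@indep_product_mass _ _ _ _ _ (cond p1 k1 a) (cond p2 k2 a)).
move=> w; rewrite !condE ?(image_prob (glue_fst same) k1) // -?same // glueE.
case: (eqVneq (k1 w.1) a) => [->|_]; last by rewrite mul0r.
rewrite (eq_sym a); case: eqP => _; last by rewrite mulr0 mul0r.
by ring.
Qed.

End Couplings.

(** * Tensorisation *)

Section Tensor.
Context (R : realType).
Local Open Scope ring_scope.

Lemma eq_prob (O : finType) (A B : eqType) (p : fdist R O) (f : O -> A)
    (g : O -> B) a b :
  (forall w, (f w == a) = (g w == b)) -> prob p f a = prob p g b.
Proof. by move=> H; rewrite /prob; apply: eq_bigl. Qed.

Lemma entr_indep (O : finType) (A B : eqType) (p : fdist R O)
    (f : O -> A) (g : O -> B) :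
  indep p f g -> entr p (fun w => (f w, g w)) = entr p f + entr p g.
Proof.
move=> fg; rewrite /entr -big_split /=; apply: eq_bigr => w _.
case: (eqVneq (p w) 0) => [->|/mass_gt0 pw]; first by rewrite !mul0r addr0.
have H1 := prob_gt0 f pw; have H2 := prob_gt0 g pw.
by rewrite fg lnM ?posrE //; ring.
Qed.

Section Product.
Context (O1 O2 : finType) (p1 : fdist R O1) (p2 : fdist R O2).

Lemma prob_cst_unit (O : finType) (p : fdist R O) : forall a, prob p (fun=> tt) a = 1.
Proof. by case; rewrite /prob eqxx mass_sum1. Qed.

Lemma same_cst_unit a : prob p1 (fun=> tt) a = prob p2 (fun=> tt) a.
Proof. by rewrite !prob_cst_unit. Qed.

(** Gluing along a constant map gives the product, so the marginal lemmas for [glue] apply. *)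
Definition prod_fdist : fdist R (O1 * O2)%type := glue same_cst_unit.

Lemma prod_fdistE w : prod_fdist w = p1 w.1 * p2 w.2.
Proof. by rewrite glueE eqxx prob_cst_unit divr1. Qed.

Lemma prod_fdist_prob (A B : eqType) (f : O1 -> A) (g : O2 -> B) a b :
  prob prod_fdist (fun w => (f w.1, g w.2)) (a, b) = prob p1 f a * prob p2 g b.
Proof.
rewrite (indep_product_mass f g prod_fdistE).
by rewrite (image_prob (glue_fst _) f) (image_prob (glue_snd _) g).
Qed.

Lemma prod_fdist_entr (A B : eqType) (f : O1 -> A) (g : O2 -> B) :
  entr prod_fdist (fun w => (f w.1, g w.2)) = entr p1 f + entr p2 g.
Proof.
rewrite (entr_indep (indep_product_mass f g prod_fdistE)).
by rewrite (image_entr (glue_fst _) f) (image_entr (glue_snd _) g).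
Qed.

End Product.

Lemma exists_notin_seq (s : seq rat) : exists l, l \notin s.
Proof.
have H x : x \in s -> `|x| <= \sum_(y <- s) `|y|.
  by move=> xs; rewrite (big_rem _ xs) /= lerDl; apply: sumr_ge0.
exists (1 + \sum_(x <- s) `|x|); apply/negP => /H.
by move=> /(le_trans (ler_norm _)); lra.
Qed.

Lemma slope_projD (r : slope) (l x y x' y' : rat) :
  slope_proj r (x + l * x') (y + l * y') = slope_proj r x y + l * slope_proj r x' y'.
Proof. by case: r => [q|] //=; ring. Qed.

(** If the second projections differ, a collision forces [l] to be one quotient of differences.
    There are finitely many such quotients, and [l] avoids them all. *)
Lemma generic_dilation (O1 O2 : finType) (F : seq slope) (X1 Y1 : O1 -> rat)
    (X2 Y2 : O2 -> rat) :
  exists l : rat, forall r, r \in F -> forall w v : O1, forall w' v' : O2,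
   slope_proj r (X1 w + l * X2 w') (Y1 w + l * Y2 w') =
   slope_proj r (X1 v + l * X2 v') (Y1 v + l * Y2 v') ->
   slope_proj r (X1 w) (Y1 w) = slope_proj r (X1 v) (Y1 v) /\
   slope_proj r (X2 w') (Y2 w') = slope_proj r (X2 v') (Y2 v').
Proof.
pose bad (u : slope * (O1 * O1 * (O2 * O2))) : rat :=
  let: (r, (w, v, (w', v'))) := u in
  (slope_proj r (X1 v) (Y1 v) - slope_proj r (X1 w) (Y1 w)) /
  (slope_proj r (X2 w') (Y2 w') - slope_proj r (X2 v') (Y2 v')).
have [l lbad] := exists_notin_seq
  [seq bad (r, u) | r <- F, u <- enum {: O1 * O1 * (O2 * O2)}].
exists l => r rF w v w' v'; rewrite !slope_projD => E.
case: (eqVneq (slope_proj r (X2 w') (Y2 w')) (slope_proj r (X2 v') (Y2 v'))) => [e|ne].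
  by rewrite e in E; split=> //; exact: addIr E.
case/negP: lbad; apply/allpairsP; exists (r, (w, v, (w', v'))).
split; rewrite ?mem_enum //= /bad.
apply: (canRL (mulfK _)); first by rewrite subr_eq0.
by move: E; rewrite mulrBr; lra.
Qed.

(** Entropy profiles of independent pairs, prescribed only on the finite list [F] so that one
    generic dilation serves all slopes involved. *)
Definition realizable (F : seq slope) (h : slope -> R) : Prop :=
  exists (O : finType) (p : fdist R O) (X Y : O -> rat),
    indep p X Y /\
    forall r, r \in F -> h r = entr p (fun w => slope_proj r (X w) (Y w)).

Section Realizable.
Context (F : seq slope).
Hypothesis F0 : slope_of 0 \in F.
Hypothesis Foo : slope_infty \in F.

Lemma realizable_ext h h' : {in F, h =1 h'} -> realizable F h -> realizable F h'.
Proof.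
move=> E [T [p [X [Y [XY H]]]]]; exists T; exists p; exists X; exists Y; split=> // r rF.
by rewrite -E ?H.
Qed.

Lemma prob_notin_image (O : finType) (A : eqType) (p : fdist R O) (f : O -> A) a :
  (forall w, (f w == a) = false) -> prob p f a = 0.
Proof. by move=> H; rewrite /prob big_pred0. Qed.

(** Combine independent copies of the two pairs by a generic [l]: each projection is then equivalent
    to a pair of projections. Slopes 0 and infinity give the same for [X] and [Y] themselves, hence
    their independence. *)
Lemma realizable_add h1 h2 : realizable F h1 -> realizable F h2 ->
  realizable F (fun r => h1 r + h2 r).
Proof.
move=> [T1 [p1 [X1 [Y1 [ind1 H1]]]]] [T2 [p2 [X2 [Y2 [ind2 H2]]]]].
have [l Hl] := generic_dilation F X1 Y1 X2 Y2.
exists (T1 * T2)%type; exists (prod_fdist p1 p2).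
pose X (w : T1 * T2) := X1 w.1 + l * X2 w.2.
pose Y (w : T1 * T2) := Y1 w.1 + l * Y2 w.2.
exists X; exists Y; split; last first.
  move=> r rF; rewrite H1 // H2 // -prod_fdist_entr; apply: entr_eq => w v _ _.
    by rewrite /X /Y => /(Hl _ rF) [-> ->].
  by rewrite /X /Y !slope_projD => -[-> ->].
have eX w v : (X w == X v) = ((X1 w.1, X2 w.2) == (X1 v.1, X2 v.2)).
  apply/eqP/eqP => [E|[]]; last by rewrite /X => -> ->.
  have /= := Hl _ F0 w.1 v.1 w.2 v.2; rewrite !mul0r !addr0 => H.
  by have [-> ->] := H E.
have eY w v : (Y w == Y v) = ((Y1 w.1, Y2 w.2) == (Y1 v.1, Y2 v.2)).
  apply/eqP/eqP => [E|[]]; last by rewrite /Y => -> ->.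
  have /= H := Hl _ Foo w.1 v.1 w.2 v.2.
  by have [-> ->] := H E.
move=> a b.
(* Values that are not attained make both sides 0; attained ones are replaced by pairs of values. *)
case: (pickP (fun w => X w == a)) => [w /eqP <-|Xa]; last first.
  by rewrite (prob_notin_image _ Xa) // mul0r prob_notin_image // => w;
     rewrite xpair_eqE Xa.
case: (pickP (fun w => Y w == b)) => [v /eqP <-|Yb]; last first.
  by rewrite (prob_notin_image _ Yb) mulr0 prob_notin_image // => u;
     rewrite xpair_eqE Yb andbF.
rewrite (eq_prob _ (fun u => eX u w)) (eq_prob _ (fun u => eY u v)).
rewrite [LHS](@eq_prob _ _ _ _ _
  (fun u => ((X1 u.1, Y1 u.1), (X2 u.2, Y2 u.2))) _
  ((X1 w.1, Y1 v.1), (X2 w.2, Y2 v.2))); last first.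
  by move=> u; rewrite !xpair_eqE eX eY !xpair_eqE andbACA.
rewrite (prod_fdist_prob _ _ (fun u => (X1 u, Y1 u)) (fun u => (X2 u, Y2 u))).
by rewrite ind1 ind2 !prod_fdist_prob mulrACA.
Qed.

Lemma realizable0 : realizable F (fun=> 0).
Proof.
pose p (w : unit) : R := 1.
have p0 w : 0 <= p w by exact: ler01.
have p1 : \sum_w p w = 1 by rewrite sumr_const card_unit.
exists unit; exists (FDist p0 p1); exists (fun=> 0); exists (fun=> 0).
split=> [a b|r _]; last first.
  by rewrite entr_cst.
have E (c : rat) : prob (FDist p0 p1) (fun=> 0) c = (0 == c)%:R.
  rewrite /prob; case: eqP => _; first exact: mass_sum1.
  by rewrite big_pred0.
rewrite !E /prob xpair_eqE -natrM mulnb; case: (_ && _); first exact: mass_sum1.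
by rewrite big_pred0.
Qed.

Lemma realizable_muln h m : realizable F h -> realizable F (fun r => m%:R * h r).
Proof.
move=> Hh; elim: m => [|m IH].
  by apply: realizable_ext realizable0 => r _; rewrite mul0r.
by apply: realizable_ext (realizable_add Hh IH) => r _; rewrite -nat1r mulrDl mul1r.
Qed.

(** Only the terms with positive multiplicity have to be realizable: later, independence holds only
    given values at atoms of positive mass. *)
Lemma realizable_sum (I : Type) (e : seq I) (m : I -> nat) (h : I -> slope -> R) :
  (forall i, (0 < m i)%N -> realizable F (h i)) ->
  realizable F (fun r => \sum_(i <- e) (m i)%:R * h i r).
Proof.
move=> Hh; elim: e => [|i e IH].
  by apply: realizable_ext realizable0 => r _; rewrite big_nil.
case: (posnP (m i)) => [mi|/Hh hi].
  by apply: realizable_ext IH => r _; rewrite big_cons mi mul0r add0r.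
apply: realizable_ext (realizable_add (realizable_muln (m i) hi) IH) => r _.
by rewrite big_cons.
Qed.

End Realizable.

(** The finite counterpart of [indep_admissible], with [L] in the role of log K. *)
Definition finitely_admissible (S : seq slope) (s : slope) (t : R) : Prop :=
  forall (O : finType) (p : fdist R O) (X Y : O -> rat) (M L : R),
    indep p X Y -> 0 <= M -> 0 <= L ->
    (forall r, r \in S ->
       M - L <= entr p (fun w => slope_proj r (X w) (Y w)) <= M + L) ->
    entr p (fun w => slope_proj s (X w) (Y w)) <= M + t * L.

(* By additivity of entropy profiles, an average of profiles is
   a limit of rescaled realizable ones. *)
Lemma finitely_admissible_cond (S : seq slope) (s : slope) (t : R) (O : finType)
    (A : eqType) (p : fdist R O) (k : O -> A) (X Y : O -> rat) (M L : R) :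
  slope_of 0 \in S -> slope_infty \in S -> finitely_admissible S s t ->
  0 <= M -> 0 <= L ->
  (forall w, 0 < p w -> indep (cond p k (k w)) X Y) ->
  (forall r, r \in S -> M - L <=
     entr p (fun w => (slope_proj r (X w) (Y w), k w)) - entr p k <= M + L) ->
  entr p (fun w => (slope_proj s (X w) (Y w), k w)) - entr p k <= M + t * L.
Proof.
move=> S0 Soo adm M0 L0 ind bnd.
pose h w r := entr (cond p k (k w)) (fun v => slope_proj r (X v) (Y v)).
have h0 w r : 0 <= h w r by exact: entr_ge0.
(* Profiles must add up at [s] as well as on [S]. *)
pose F := s :: S.
have FS r : r \in S -> r \in F by move=> rS; rewrite inE rS orbT.
pose B := \sum_w \sum_(r <- F) h w r.
have B0 : 0 <= B by apply: sumr_ge0 => w _; apply: sumr_ge0.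
pose H r := \sum_w p w * h w r.
have HE r : entr p (fun w => (slope_proj r (X w) (Y w), k w)) - entr p k = H r.
  by rewrite -cond_entr.
rewrite HE; have {}bnd r : r \in S -> M - L <= H r <= M + L.
  by move=> rS; rewrite -HE bnd.
(* Take [Num.truncn (n * p w)] copies of the pair conditioned at [w]. Rounding loses at most [B] at
   every slope, whatever [n] is. *)
have key n : n%:R * H s - B <= n%:R * M + t * (n%:R * L + B).
  have n0 : 0 <= n%:R :> R by exact: ler0n.
  pose m w := Num.truncn (n%:R * p w).
  pose g r := \sum_w (m w)%:R * h w r.
  have mE w : (m w)%:R <= n%:R * p w < (m w)%:R + 1.
    by rewrite natr1; apply: truncn_itv; rewrite mulr_ge0 ?mass_ge0.
  have g_le r : g r <= n%:R * H r.
    rewrite mulr_sumr; apply: ler_sum => w _; rewrite mulrA.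
    by apply: ler_wpM2r => //; case/andP: (mE w).
  have g_ge r : r \in F -> n%:R * H r - B <= g r.
    move=> rF; rewrite mulr_sumr -sumrB; apply: ler_sum => w _.
    have hr : h w r <= \sum_(r <- F) h w r.
      by rewrite (big_rem _ rF) /= lerDl; apply: sumr_ge0.
    have /andP[_ /ltW mw] := mE w.
    have := ler_wpM2r (h0 w r) mw; rewrite mulrDl mul1r -mulrA; lra.
  have [T' [q [X' [Y' [indq Hq]]]]] : realizable F g.
    apply: (realizable_sum (FS _ S0) (FS _ Soo)) => w mw.
    exists O; exists (cond p k (k w)); exists X; exists Y; split=> //; apply: ind.
    apply: mass_gt0; apply/eqP => pw0.
    by move: mw; rewrite /m pw0 mulr0 truncn0.
  have := adm T' q X' Y' (n%:R * M) (n%:R * L + B) indq.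
  rewrite -(Hq s) ?mem_head // => /(_ (mulr_ge0 n0 M0) (addr_ge0 (mulr_ge0 n0 L0) B0)).
  have := g_ge s (mem_head _ _) => H1 H2; apply: (le_trans H1); apply: H2 => r rS.
  rewrite -Hq ?FS //; have := g_le r; have := g_ge r (FS _ rS) => H3 H4.
  have /andP[H5 H6] := bnd r rS.
  have := ler_wpM2l n0 H5; have := ler_wpM2l n0 H6; rewrite mulrBr mulrDr; lra.
(* Let [n] tend to infinity: an excess [e] would give [n * e <= (1 + t) * B] for all [n]. *)
rewrite leNgt; apply/negP => e0.
have {}e0 : 0 < H s - (M + t * L) by rewrite subr_gt0.
set e := H s - _ in e0.
have := archi_boundP (x := `|(1 + t) * B / e|) (normr_ge0 _).
set n := Num.bound _ => nB.
have := key n.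
have : (1 + t) * B / e < n%:R by apply: le_lt_trans nB; exact: ler_norm.
rewrite ltr_pdivrMr // /e; lra.
Qed.

End Tensor.

(** * Passing between random variables and finite distributions *)

Section Transfer.
Context (R : realType).
Local Open Scope classical_set_scope.
Local Open Scope ring_scope.

Lemma fsum_finType (I : finType) (D : set I) (F : I -> \bar R) :
  (\sum_(i \in D) F i = \sum_(i | i \in D) F i)%E.
Proof.
rewrite (fsbigE (enum [pred i | i \in D])) ?enum_uniq //.
- by rewrite big_enum_cond; apply: eq_bigl => i; rewrite inE andbb.
- by move=> i /=; rewrite mem_enum !inE.
- by move=> i Di; rewrite mem_enum inE mem_set.
Qed.

Definition has_law (d : measure_display) (T : measurableType d)
    (P : probability T R) (O : finType) (p : fdist R O) (Phi : T -> O) : Prop :=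
  forall w, measurable (Phi @^-1` [set w]) /\ P (Phi @^-1` [set w]) = (p w)%:E.

Section Law.
Context (d : measure_display) (T : measurableType d) (P : probability T R).
Context (O : finType) (p : fdist R O) (Phi : T -> O).
Hypothesis law : has_law P p Phi.

Lemma law_preimage (A : eqType) (f : O -> A) a :
  (fun w => f (Phi w)) @^-1` [set a] =
  \bigcup_(w in [set w | f w = a]) (Phi @^-1` [set w]).
Proof.
by apply/seteqP; split=> [w /= fw|w [v /= <- ->]] //; exists (Phi w).
Qed.

Lemma law_measurable (A : eqType) (f : O -> A) a :
  measurable ((fun w => f (Phi w)) @^-1` [set a]).
Proof.
rewrite law_preimage; apply: fin_bigcup_measurable => [|w _].
  exact: finite_finset.
by case: (law w).
Qed.

Lemma law_prob (A : eqType) (f : O -> A) a :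
  P ((fun w => f (Phi w)) @^-1` [set a]) = (prob p f a)%:E.
Proof.
rewrite law_preimage measure_fin_bigcup.
- rewrite fsum_finType -sumEFin; apply: eq_big => w.
    by apply/idP/eqP; rewrite inE.
  by case: (law w).
- exact: finite_finset.
- by move=> w v _ _ [x [/= <- <-]].
- by move=> w _; case: (law w).
Qed.

Lemma law_finite_rv (f : O -> rat) : finite_rv (fun w => f (Phi w)).
Proof.
split; last exact: law_measurable.
apply: (@sub_finite_set _ _ (range f)); first by move=> _ [w _ <-]; exists (Phi w).
by apply: finite_image; exact: finite_finset.
Qed.

Lemma law_entropy (f : O -> rat) : entropy P (fun w => f (Phi w)) = entr p f.
Proof.
set g := fun w => f (Phi w).
have fing : finite_set (range g) by have [] := law_finite_rv f.
rewrite /entropy fsbig_finite //; set A := fset_set _.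
pose G q := - ln (prob p f q).
transitivity (\sum_(q <- A) \sum_(w | f w == q) p w * G q).
  apply: eq_bigr => q _; rewrite law_prob /= -mulr_suml; congr (_ * _).
  (* At probability 0 the conventions [0^-1 = 0] and [ln 0 = 0] make both sides 0. *)
  rewrite /G div1r; have := prob_ge0 p f q; rewrite le_eqVlt => /predU1P[<-|q0].
    by rewrite invr0 ln0 ?oppr0.
  by rewrite lnV ?posrE.
rewrite (exchange_big_dep xpredT) //=; apply: eq_bigr => w _.
case: (eqVneq (p w) 0) => [->|/mass_gt0 pw].
  by rewrite mul0r big1 // => q _; rewrite mul0r.
under eq_bigl do rewrite eq_sym.
(* [A] may miss values of [f] at null atoms, but an atom of positive mass has a nonempty fibre under
   [Phi]. *)
suff fwA : f w \in A.
  rewrite big_mkcond (bigD1_seq (f w)) ?fset_uniq //= eqxx big1 ?addr0 //.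
  by move=> q /negPf ->.
rewrite in_fset_set // inE.
have [mw Pw] := law w.
have [x /= <-] : Phi @^-1` [set w] !=set0.
  apply/set0P/eqP => e; move: Pw; rewrite e measure0 => -[/esym].
  by apply/eqP; rewrite gt_eqF.
by exists x.
Qed.

End Law.

Section Realization.
Context (O : finType) (p : fdist R O) (w0 : O).

(** The sample space is [nat], where all sets are measurable; [w0] is the value past the last index,
    where there is no mass. *)
Definition fdist_enum (i : nat) : O := nth w0 (enum O) i.

Let point_mass (i : nat) : {measure set nat -> \bar R} :=
  mscale (NngNum (mass_ge0 p (fdist_enum i))) \d_i.

Definition fdist_measure : set nat -> \bar R := msum point_mass #|O|.

HB.instance Definition _ := Measure.on fdist_measure.

Lemma fdist_measureE (A : set nat) :
  fdist_measure A = (\sum_(i < #|O|) p (fdist_enum i) * (\1_A (i : nat)))%:E.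
Proof.
rewrite /fdist_measure /msum -sumEFin; apply: eq_bigr => i _.
by rewrite /point_mass /= /mscale /= diracE EFinM indicE.
Qed.

Lemma sum_fdist_enum (F : O -> R) : \sum_(i < #|O|) F (fdist_enum i) = \sum_w F w.
Proof.
transitivity (\sum_(w <- enum O) F w); last by rewrite big_enum.
by rewrite (big_nth w0) big_mkord -cardE.
Qed.

Let fdist_measureT : fdist_measure setT = 1%E.
Proof.
rewrite fdist_measureE.
under eq_bigr do rewrite indicT mulr1.
by rewrite sum_fdist_enum mass_sum1.
Qed.

HB.instance Definition _ :=
  @Measure_isProbability.Build _ _ R fdist_measure fdist_measureT.

Lemma fdist_measure_law : has_law fdist_measure p fdist_enum.
Proof.
move=> w; split=> //; apply: (etrans (fdist_measureE _)); congr _%:E.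
rewrite -(prob_id p w) probE -sum_fdist_enum; apply: eq_bigr => i _.
rewrite indicE; congr (_ * (nat_of_bool _)%:R).
by apply/idP/eqP; rewrite inE.
Qed.

End Realization.

Lemma exists_law (O : finType) (p : fdist R O) :
  exists (P : probability nat R) (Phi : nat -> O), has_law P p Phi.
Proof.
(* Total mass 1 forces [O] to be inhabited. *)
have [w0 _] : exists w0 : O, true.
  case: (pickP (fun w : O => true)) => [w _|H]; first by exists w.
  have := mass_sum1 p; rewrite big_pred0 // => /esym/eqP.
  by rewrite oner_eq0.
by exists (fdist_measure p w0), (fdist_enum w0); exact: fdist_measure_law.
Qed.

(** Realise the finite distribution on [nat] and take K to be [expR L]. *)
Lemma indep_admissible_finite (S : {fset slope}) (s : slope) (t : R) :
  indep_admissible S s t -> finitely_admissible S s t.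
Proof.
move=> adm O p X Y M L ind M0 L0 bnd.
have [P [Phi law]] := exists_law p.
have E r : entropy P (proj_rv r (fun w => X (Phi w)) (fun w => Y (Phi w))) =
    entr p (fun w => slope_proj r (X w) (Y w)).
  exact: (law_entropy law (fun w => slope_proj r (X w) (Y w))).
have := adm _ _ P (fun w => X (Phi w)) (fun w => Y (Phi w)) M (expR L).
rewrite E expRK; apply=> //.
- exact: law_finite_rv law X.
- exact: law_finite_rv law Y.
- move=> a b; rewrite (law_prob law X) (law_prob law Y) -EFinM -ind.
  rewrite -(law_prob law (fun w => (X w, Y w))); congr (P _).
  by apply/seteqP; split=> w /= => [[-> ->]|[-> ->]].
- by rewrite -expR0 ler_expR.
- by move=> r rS; rewrite E; exact: bnd.
Qed.

(** The finite space is the range of [(X, Y)] itself. Hence [(U, V)] is injective, and a path of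
    edges can be recovered from its vertices. *)
Lemma exists_fdist_of_pair (d : measure_display) (T : measurableType d)
    (P : probability T R) (X Y : T -> rat) : finite_rv X -> finite_rv Y ->
  exists (O : finType) (p : fdist R O) (U V : O -> rat),
    (forall w v, U w = U v -> V w = V v -> w = v) /\
    forall r, entropy P (proj_rv r X Y) =
              entr p (fun w => slope_proj r (U w) (V w)).
Proof.
move=> [finX mX] [finY mY].
pose XY w := (X w, Y w).
have finXY : finite_set (range XY).
  apply: (@sub_finite_set _ _ (range X `*` range Y)); last exact: finite_setX.
  by move=> _ [w _ <-]; split; exists w.
pose A := fset_set (range XY).
have memA w : XY w \in A by rewrite in_fset_set // inE; exists w.
pose Phi w : A := [` memA w]%fset.
have mPhi a : measurable (Phi @^-1` [set a]).
  rewrite (_ : _ @^-1` _ = X @^-1` [set (val a).1] `&` Y @^-1` [set (val a).2]).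
    exact: measurableI.
  apply/seteqP; split=> w /=; first by move=> <-.
  by move=> [Xw Yw]; apply: val_inj; rewrite /= /XY Xw Yw -surjective_pairing.
pose m a := fine (P (Phi @^-1` [set a])).
have mE a : P (Phi @^-1` [set a]) = (m a)%:E by rewrite fineK // fin_num_measure.
have m0 a : 0 <= m a by rewrite fine_ge0.
have m1 : \sum_a m a = 1.
  apply: EFin_inj; rewrite -sumEFin -(probability_setT P).
  under eq_bigr do rewrite -mE.
  rewrite (_ : setT = \bigcup_(a in setT) (Phi @^-1` [set a])); last first.
    by apply/esym/seteqP; split=> // w _; exists (Phi w).
  rewrite measure_fin_bigcup //.
  - by rewrite fsum_finType; apply: eq_bigl => a; rewrite mem_set.
  - exact: finite_finset.
  - by move=> a b _ _ [x [/= <- <-]].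
pose p := FDist m0 m1.
have law : has_law P p Phi by move=> a; split.
exists A; exists p; exists (fun a => (val a).1); exists (fun a => (val a).2); split.
- by move=> [[a1 a2] ha] [[b1 b2] hb] /= e1 e2; apply: val_inj; rewrite /= e1 e2.
- by move=> r; rewrite -(law_entropy law).
Qed.

End Transfer.

(** * The path inequalities *)

Section Chain.
Context (R : realType).
Local Open Scope ring_scope.

Lemma entr_subadd (O : finType) (A B C : eqType) (p : fdist R O) (f : O -> A)
    (g : O -> B) (u : O -> C) :
  determines p (fun w => (f w, g w)) u -> entr p u <= entr p f + entr p g.
Proof.
move=> fgu; rewrite -[leLHS]addr0 -(entr_cst p tt).
exact: (entr_submod (k := fun=> tt)) fgu.
Qed.

Lemma entr2_le (O : finType) (A B : eqType) (p : fdist R O) (f : O -> A)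
    (g : O -> B) a b :
  entr p f <= a -> entr p g <= b -> entr p (fun w => (f w, g w)) <= a + b.
Proof.
move=> fa gb; apply: (le_trans _ (lerD fa gb)).
by apply: entr_subadd => w v _ _.
Qed.

Section ChainBound.
Context (O : finType) (p : fdist R O) (x1 y1 x2 y2 x3 y3 : O -> rat).
Context (S : seq slope) (q : rat) (t M D : R).
Hypothesis S1 : slope_of 1 \in S.

Let all6 w := (x1 w, y1 w, x2 w, y2 w, x3 w, y3 w).
Let edge r (x y : O -> rat) w := slope_proj r (x w) (y w).

Hypothesis le_x1 : entr p x1 <= M.
Hypothesis le_y1 : entr p y1 <= M.
Hypothesis le_x2 : entr p x2 <= M.
Hypothesis le_y2 : entr p y2 <= M.
Hypothesis le_x3 : entr p x3 <= M.
Hypothesis le_y3 : entr p y3 <= M.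
Hypothesis le_x1y1 : forall r, r \in S -> entr p (edge r x1 y1) <= M.
Hypothesis le_x2y1 : forall r, r \in S -> entr p (edge r x2 y1) <= M.
Hypothesis le_x2y2 : forall r, r \in S -> entr p (edge r x2 y2) <= M.
Hypothesis le_x3y2 : forall r, r \in S -> entr p (edge r x3 y2) <= M.
Hypothesis le_x3y3 : forall r, r \in S -> entr p (edge r x3 y3) <= M.
Hypothesis ge_all6 : 6 * M - 5 * D <= entr p all6.

(* [x1 + r y3] is the alternating sum of the five edge sums. *)
Lemma entr_endpoints_le r : r \in S -> entr p (edge r x1 y3) <= M + 5 * D.
Proof.
(* Nonnegativity settles slopes infinity and 0, where the projection is an endpoint of entropy at
   most [M]. *)
have D0 : 0 <= D.
  have : entr p all6 <= M + M + M + M + M + M.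
    exact: entr2_le (entr2_le (entr2_le (entr2_le (entr2_le le_x1 le_y1)
      le_x2) le_y2) le_x3) le_y3.
  move: ge_all6; lra.
case: r => [r|] rS; last first.
  by apply: (@le_trans _ _ M) => //; move: D0; lra.
case: (eqVneq r 0) => [->|r0].
  apply: (@le_trans _ _ M); last by move: D0; lra.
  apply: le_trans le_x1; apply: entr_mono => w v _ _.
  by rewrite /edge /= !mul0r !addr0.
pose s5 w := (edge (Some r) x1 y1 w, edge (Some r) x2 y1 w,
  edge (Some r) x2 y2 w, edge (Some r) x3 y2 w, edge (Some r) x3 y3 w).
have le_s5 : entr p s5 <= M + M + M + M + M.
  exact: entr2_le (entr2_le (entr2_le (entr2_le (le_x1y1 rS) (le_x2y1 rS))
    (le_x2y2 rS)) (le_x3y2 rS)) (le_x3y3 rS).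
have le_ends : entr p (fun w => (x1 w, y3 w)) <= M + M by exact: entr2_le.
have rI := mulfI r0.
(* The endpoints and the five edge sums recover all vertices, with a division by [r] at [y1] and
   [y2]. The count is [2M + 5M - (6M - 5D)]. *)
have : entr p all6 + entr p (edge (Some r) x1 y3) <=
    entr p (fun w => (x1 w, y3 w)) + entr p s5.
  apply: entr_submod => w v _ _; rewrite /s5 /all6 /edge /=.
- by move=> [-> ->].
- by move=> []; lra.
- move=> [e1 e2 h1 h2 h3 h4 h5].
  have y1E : y1 w = y1 v by apply: rI; lra.
  have x2E : x2 w = x2 v by move: h2; rewrite y1E; lra.
  have y2E : y2 w = y2 v by apply: rI; lra.
  have x3E : x3 w = x3 v by move: h4; rewrite y2E; lra.
  by rewrite e1 e2 y1E x2E y2E x3E.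
move: ge_all6 le_s5 le_ends; lra.
Qed.


(** The difference is a function both of [(x1, x2)] and of the two slope-1 sums through [y1].
    Jointly these give [(x1, x2, y1)], of entropy at least [3M - 5D]. *)
Lemma entr_left_le : entr p (fun w => x1 w - x2 w) <= M + 5 * D.
Proof.
have le_sums : entr p (fun w => (x1 w + y1 w, x2 w + y1 w)) <= M + M.
  apply: entr2_le.
    apply: le_trans (le_x1y1 S1); apply: entr_mono => w v _ _.
    by rewrite /edge /= !mul1r.
  apply: le_trans (le_x2y1 S1); apply: entr_mono => w v _ _.
  by rewrite /edge /= !mul1r.
have le_ends : entr p (fun w => (x1 w, x2 w)) <= M + M by exact: entr2_le.
have le_all : entr p all6 <=
    entr p (fun w => (x1 w, x2 w, y1 w)) + (M + M + M).
  apply: (le_trans _ (lerD (lexx _) (entr2_le (entr2_le le_y2 le_x3) le_y3))).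
  by apply: entr_subadd => w v _ _; rewrite /all6 => -[-> -> -> -> -> ->].
have : entr p (fun w => (x1 w, x2 w, y1 w)) + entr p (fun w => x1 w - x2 w) <=
    entr p (fun w => (x1 w, x2 w)) + entr p (fun w => (x1 w + y1 w, x2 w + y1 w)).
  apply: entr_submod => w v _ _.
  - by move=> [-> ->].
  - by move=> []; lra.
  - by move=> [-> -> /addrI ->].
move: ge_all6; lra.
Qed.

(** Mirror image of [entr_left_le], with sums through [x3]. *)
Lemma entr_right_le : entr p (fun w => y3 w - y2 w) <= M + 5 * D.
Proof.
have le_sums : entr p (fun w => (x3 w + y3 w, x3 w + y2 w)) <= M + M.
  apply: entr2_le.
    apply: le_trans (le_x3y3 S1); apply: entr_mono => w v _ _.
    by rewrite /edge /= !mul1r.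
  apply: le_trans (le_x3y2 S1); apply: entr_mono => w v _ _.
  by rewrite /edge /= !mul1r.
have le_ends : entr p (fun w => (y3 w, y2 w)) <= M + M by exact: entr2_le.
have le_all : entr p all6 <=
    entr p (fun w => (y3 w, y2 w, x3 w)) + (M + M + M).
  apply: (le_trans _ (lerD (lexx _) (entr2_le (entr2_le le_x1 le_y1) le_x2))).
  by apply: entr_subadd => w v _ _; rewrite /all6 => -[-> -> -> -> -> ->].
have : entr p (fun w => (y3 w, y2 w, x3 w)) + entr p (fun w => y3 w - y2 w) <=
    entr p (fun w => (y3 w, y2 w)) + entr p (fun w => (x3 w + y3 w, x3 w + y2 w)).
  apply: entr_submod => w v _ _.
  - by move=> [-> ->].
  - by move=> []; lra.
  - by move=> [-> -> /addIr ->].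
move: ge_all6; lra.
Qed.

(** This is the input of [finitely_admissible_cond] with [L = 5D]. Above, the conditioning is
    dropped; below, the edge value, [y1] and four more vertices determine the whole path. *)
Lemma cond_entr_endpoints r : r \in S -> M - 5 * D <=
  entr p (fun w => (edge r x1 y3 w, y1 w)) - entr p y1 <= M + 5 * D.
Proof.
move=> rS; apply/andP; split; last first.
  by have := entr2_le (entr_endpoints_le rS) (lexx (entr p y1)); lra.
suff : entr p all6 <= entr p (fun w => (edge r x1 y3 w, y1 w)) + (M + M + M + M).
  move: ge_all6 le_y1; lra.
case: r {rS} => [r|].
  apply: (le_trans _ (lerD (lexx _)
    (entr2_le (entr2_le (entr2_le le_x2 le_y2) le_x3) le_y3))).
  apply: entr_subadd => w v _ _; rewrite /all6 /edge /= => -[e -> -> -> -> e3].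
  by move: e; rewrite e3 => /addIr ->.
apply: (le_trans _ (lerD (lexx _)
  (entr2_le (entr2_le (entr2_le le_x1 le_x2) le_y2) le_x3))).
by apply: entr_subadd => w v _ _; rewrite /all6 /edge /= => -[-> -> -> -> -> ->].
Qed.

Hypothesis ge_x2y2 : 2 * M - D <= entr p (edge (Some q) x2 y2).
Hypothesis le_x1y3 :
  entr p (fun w => (edge (Some q) x1 y3 w, y1 w)) - entr p y1 <= M + t * (5 * D).

(* [x2 + q y2] is the translate of [x1 + q y3] by a function of the pair
   [x1 - x2, y3 - y2], which is nearly independent of [x2, y2]. *)
Lemma chain_bound : M <= (5 * t + 21) * D.
Proof.
pose u w := edge (Some q) x2 y2 w.
(* The loss is [10D] from the two differences and [5D] from the joint entropy of all vertices but
   [x3], which is at least [5M - 5D]. *)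
have up : entr p (fun w => (u w, y1 w)) <=
    entr p (fun w => (edge (Some q) x1 y3 w, y1 w)) + 12 * D + 3 * D.
  have le_dif : entr p (fun w => (u w, x1 w - x2 w, y3 w - y2 w, y1 w)) <=
    entr p (fun w => (edge (Some q) x1 y3 w, y1 w)) + (M + 5 * D + (M + 5 * D)).
    apply: (le_trans _ (lerD (lexx _) (entr2_le entr_left_le entr_right_le))).
    apply: entr_subadd => w v _ _; rewrite /u /edge /= => -[e -> e1 e2].
    rewrite e1 e2; congr (_, _, _, _).
    have -> : x2 w + q * y2 w =
        x1 w + q * y3 w - (x1 w - x2 w) - q * (y3 w - y2 w) by ring.
    by rewrite e e1 e2; ring.
  have le3 : entr p (fun w => (x2 w, y2 w, y1 w)) <= M + M + M.
    exact: entr2_le (entr2_le le_x2 le_y2) le_y1.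
  have le_all : entr p all6 <=
      entr p (fun w => (x1 w, y1 w, x2 w, y2 w, y3 w)) + M.
    apply: (le_trans _ (lerD (lexx _) le_x3)).
    by apply: entr_subadd => w v _ _; rewrite /all6 => -[-> -> -> -> -> ->].
  have : entr p (fun w => (x1 w, y1 w, x2 w, y2 w, y3 w)) +
      entr p (fun w => (u w, y1 w)) <=
      entr p (fun w => (u w, x1 w - x2 w, y3 w - y2 w, y1 w)) +
      entr p (fun w => (x2 w, y2 w, y1 w)).
    apply: entr_submod => w v _ _.
    - by move=> [-> _ _ ->].
    - by rewrite /u /edge => -[-> -> ->].
    - move=> [_ e1 e2 _ x2E y2E ->]; move: e1 e2.
      by rewrite x2E y2E => /addIr -> /addIr ->.
  move: ge_all6; lra.
(* [u] carries almost all of [(x2, y2)], which is nearly independent of [y1]: [5D] is lost in the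
   path and [D] in [u]. *)
have low : 3 * M - 6 * D <= entr p (fun w => (u w, y1 w)).
  have le2 : entr p (fun w => (x2 w, y2 w)) <= M + M by exact: entr2_le.
  have le_all : entr p all6 <=
      entr p (fun w => (x2 w, y2 w, y1 w)) + (M + M + M).
    apply: (le_trans _ (lerD (lexx _) (entr2_le (entr2_le le_x1 le_x3) le_y3))).
    by apply: entr_subadd => w v _ _; rewrite /all6 => -[-> -> -> -> -> ->].
  have : entr p (fun w => (x2 w, y2 w, y1 w)) + entr p u <=
      entr p (fun w => (u w, y1 w)) + entr p (fun w => (x2 w, y2 w)).
    apply: entr_submod => w v _ _.
    - by move=> [->].
    - by rewrite /u /edge => -[-> ->].
    - by move=> [_ -> -> ->].
  move: ge_all6 ge_x2y2; rewrite -/u; lra.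
move: le_x1y3 le_y1; lra.
Qed.

End ChainBound.
End Chain.

(** * The bound for finite distributions *)

Section Main.
Context (R : realType).
Local Open Scope ring_scope.

Lemma is_image_comp (O1 O2 O3 : finType) (p : fdist R O1) (q : fdist R O2)
    (r : fdist R O3) (phi : O1 -> O2) (psi : O2 -> O3) :
  is_image p phi q -> is_image q psi r -> is_image p (fun w => psi (phi w)) r.
Proof. by move=> pq qr v; rewrite (image_prob pq) qr. Qed.

(* The edges of the path [x1 - y1 - x2 - y2 - x3 - y3] of copies of [(U, V)]. *)
Lemma exists_path (O : finType) (p : fdist R O) (U V : O -> rat) :
  exists (W : finType) (P : fdist R W) (e1 e2 e3 e4 e5 : W -> O),
    [/\ is_image P e1 p, is_image P e2 p, is_image P e3 p, is_image P e4 p &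
        is_image P e5 p] /\
    [/\ forall w, 0 < P w -> [/\ V (e1 w) = V (e2 w), U (e2 w) = U (e3 w),
          V (e3 w) = V (e4 w) & U (e4 w) = U (e5 w)],
        forall w v, e1 w = e1 v -> e2 w = e2 v -> e3 w = e3 v -> e4 w = e4 v ->
          e5 w = e5 v -> w = v,
        entr P id = 5 * entr p id - 2 * entr p U - 2 * entr p V &
        forall w, 0 < P w -> indep (cond P (fun w => V (e1 w)) (V (e1 w)))
          (fun w => U (e1 w)) (fun w => V (e5 w))].
Proof.
(* The path is built from its far end, prepending one edge at a time. The last gluing is along [y1],
   so [glue_cond_indep] yields the conditional independence of [x1] and [y3]. *)
have same1 a : prob p U a = prob p U a by [].
pose P1 := glue same1.
have P1f : is_image P1 fst p := glue_fst same1.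
have P1s : is_image P1 snd p := glue_snd same1.
have same2 a : prob p V a = prob P1 (fun w => V w.1) a by rewrite (image_prob P1f).
pose P2 := glue same2.
have P2f : is_image P2 fst p := glue_fst same2.
have P2s : is_image P2 snd P1 := glue_snd same2.
have same3 a : prob p U a = prob P2 (fun w => U w.1) a by rewrite (image_prob P2f).
pose P3 := glue same3.
have P3f : is_image P3 fst p := glue_fst same3.
have P3s : is_image P3 snd P2 := glue_snd same3.
have same4 a : prob p V a = prob P3 (fun w => V w.1) a by rewrite (image_prob P3f).
pose P4 := glue same4.
have P4f : is_image P4 fst p := glue_fst same4.
have P4s : is_image P4 snd P3 := glue_snd same4.
exists (O * (O * (O * (O * O))))%type; exists P4.
exists (fun w => w.1); exists (fun w => w.2.1); exists (fun w => w.2.2.1).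
exists (fun w => w.2.2.2.1); exists (fun w => w.2.2.2.2).
split.
  have P42 := is_image_comp P4s P3s; have P41 := is_image_comp P42 P2s.
  split=> //; first exact: is_image_comp P4s P3f.
  - exact: is_image_comp P42 P2f.
  - exact: is_image_comp P41 P1f.
  - exact: is_image_comp P41 P1s.
split.
- move=> w w0; have w1 := image_gt0 P4s w0; have w2 := image_gt0 P3s w1.
  have w3 := image_gt0 P2s w2.
  by rewrite (glue_eq w0) (glue_eq w1) (glue_eq w2) (glue_eq w3).
- by move=> [a [b [c [x y]]]] [a' [b' [c' [x' y']]]] /= -> -> -> -> ->.
- by rewrite !glue_entr; ring.
move=> w w0; apply: (glue_cond_indep same4 U (fun w => V w.2.2.2)).
by rewrite gt_eqF // prob_gt0 // (image_gt0 P4f).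
Qed.

Lemma finite_SD_bound (O : finType) (p : fdist R O) (U V : O -> rat)
    (S : seq slope) (q : rat) (t M : R) :
  (forall w v, U w = U v -> V w = V v -> w = v) ->
  slope_of 0 \in S -> slope_of 1 \in S -> slope_infty \in S ->
  1 <= t -> finitely_admissible S (slope_of q) t ->
  (forall r, r \in S -> entr p (fun w => slope_proj r (U w) (V w)) <= M) ->
  entr p (fun w => slope_proj (slope_of q) (U w) (V w)) <= (2 - 26^-1 / t) * M.
Proof.
move=> inj S0 S1 Soo t1 adm le_M.
set H := entr p _; pose D := 2 * M - H.
have leU : entr p U <= M.
  apply: le_trans (le_M _ S0); apply: entr_mono => w v _ _ /=.
  by rewrite !mul0r !addr0.
have leV : entr p V <= M by exact: le_M Soo.
have M0 : 0 <= M by apply: le_trans leU; exact: entr_ge0.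
have HUV : H <= entr p U + entr p V.
  by apply: entr_subadd => w v _ _ [-> ->].
have Hid : H <= entr p id by apply: entr_mono => w v _ _ ->.
have [W [P [e1 [e2 [e3 [e4 [e5 [[i1 i2 i3 i4 i5] [eqs inje entP ind]]]]]]]]] :=
  exists_path p U V.
pose x1 w := U (e1 w); pose y1 w := V (e1 w); pose x2 w := U (e2 w).
pose y2 w := V (e3 w); pose x3 w := U (e4 w); pose y3 w := V (e5 w).
have leE (A : eqType) (f : W -> A) (g : O -> A) (e : W -> O) : is_image P e p ->
    (forall w, 0 < P w -> f w = g (e w)) -> entr P f = entr p g.
  move=> im fg; rewrite -(image_entr im g).
  by apply: entr_eq => w v w0 v0; rewrite !fg.
have edgeE r : [/\ entr P (fun w => slope_proj r (x1 w) (y1 w)) =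
       entr p (fun w => slope_proj r (U w) (V w)),
     entr P (fun w => slope_proj r (x2 w) (y1 w)) =
       entr p (fun w => slope_proj r (U w) (V w)),
     entr P (fun w => slope_proj r (x2 w) (y2 w)) =
       entr p (fun w => slope_proj r (U w) (V w)),
     entr P (fun w => slope_proj r (x3 w) (y2 w)) =
       entr p (fun w => slope_proj r (U w) (V w)) &
     entr P (fun w => slope_proj r (x3 w) (y3 w)) =
       entr p (fun w => slope_proj r (U w) (V w))].
  split; [exact: (leE _ _ _ _ i1) | apply: (leE _ _ _ _ i2) |
    apply: (leE _ _ _ _ i3) | apply: (leE _ _ _ _ i4) |
    apply: (leE _ _ _ _ i5)] => w /eqs[h1 h2 h3 h4];
  by rewrite /x1 /y1 /x2 /y2 /x3 /y3 ?h1 ?h2 ?h3 ?h4.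
(* By injectivity the six vertices determine the five edges, so the entropy is at least [5H - 4M]
   with [H = 2M - D]. *)
have all6 : 6 * M - 5 * D <= entr P (fun w => (x1 w, y1 w, x2 w, y2 w, x3 w, y3 w)).
  have -> : entr P (fun w => (x1 w, y1 w, x2 w, y2 w, x3 w, y3 w)) = entr P id.
    apply: entr_eq => w v w0 v0; first by move=> ->.
    have [h1 h2 h3 h4] := eqs _ w0; have [k1 k2 k3 k4] := eqs _ v0.
    rewrite /x1 /y1 /x2 /y2 /x3 /y3 => -[f1 f2 f3 f4 f5 f6].
    by apply: inje; apply: inj; congruence.
  by rewrite entP /D; lra.
have lex1 : entr P x1 <= M by rewrite (image_entr i1 U).
have ley1 : entr P y1 <= M by rewrite (image_entr i1 V).
have lex2 : entr P x2 <= M by rewrite (image_entr i2 U).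
have ley2 : entr P y2 <= M by rewrite (image_entr i3 V).
have lex3 : entr P x3 <= M by rewrite (image_entr i4 U).
have ley3 : entr P y3 <= M by rewrite (image_entr i5 V).
have l11 r : r \in S -> entr P (fun w => slope_proj r (x1 w) (y1 w)) <= M.
  by move=> rS; case: (edgeE r) => -> *; exact: le_M.
have l21 r : r \in S -> entr P (fun w => slope_proj r (x2 w) (y1 w)) <= M.
  by move=> rS; case: (edgeE r) => _ -> *; exact: le_M.
have l22 r : r \in S -> entr P (fun w => slope_proj r (x2 w) (y2 w)) <= M.
  by move=> rS; case: (edgeE r) => _ _ -> *; exact: le_M.
have l32 r : r \in S -> entr P (fun w => slope_proj r (x3 w) (y2 w)) <= M.
  by move=> rS; case: (edgeE r) => _ _ _ -> *; exact: le_M.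
have l33 r : r \in S -> entr P (fun w => slope_proj r (x3 w) (y3 w)) <= M.
  by move=> rS; case: (edgeE r) => _ _ _ _ ->; exact: le_M.
have D0 : 0 <= 5 * D by rewrite /D; lra.
have bnd := cond_entr_endpoints lex1 ley1 lex2 ley2 lex3 ley3 l11 l21 l22 l32 l33 all6.
have up := finitely_admissible_cond S0 Soo adm M0 D0 ind bnd.
have low : 2 * M - D <= entr P (fun w => slope_proj (slope_of q) (x2 w) (y2 w)).
  by case: (edgeE (slope_of q)) => _ _ -> *; rewrite -/H /D; lra.
have key : M <= (5 * t + 21) * D.
  exact: (chain_bound S1 lex1 ley1 lex2 ley2 lex3 ley3 l11 l21 l32 l33 all6 low up).
(* Since [t >= 1], [5t + 21 <= 26t]; this is the source of the constant 26. *)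
have {}key : M <= 26 * t * D.
  by apply: (le_trans key); apply: ler_wpM2r; [move: D0; lra | lra].
have t0 : 0 < t by lra.
suff : 26^-1 / t * M <= D by rewrite mulrBl /D; lra.
by rewrite -invfM mulrC ler_pdivrMr ?mulr_gt0 // mulrC.
Qed.

(* Test on a fair bit [X] and [Y = 0], with [M = L = ln 2 / 2]. *)
Lemma finitely_admissible_ge1 (S : seq slope) (q : rat) (t : R) :
  finitely_admissible S (slope_of q) t -> 1 <= t.
Proof.
move=> adm; pose m (b : bool) : R := 2^-1.
have m0 b : 0 <= m b by rewrite /m invr_ge0.
have m1 : \sum_b m b = 1 by rewrite big_bool /m /=; lra.
pose p := FDist m0 m1.
pose X (b : bool) : rat := b%:R.
have ind : indep p X (fun=> 0 : rat).
  move=> a b; case: (eqVneq b 0) => [->|b0].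
    have -> : prob p (fun=> 0 : rat) 0 = 1 by rewrite /prob eqxx mass_sum1.
    by rewrite mulr1; apply: eq_prob => w; rewrite xpair_eqE eqxx andbT.
  have nb : (0 == b) = false by rewrite eq_sym (negPf b0).
  rewrite (@prob_notin_image _ _ _ p (fun=> 0) b) // mulr0.
  by rewrite prob_notin_image // => w; rewrite xpair_eqE nb andbF.
have ln2 : 0 < ln 2 :> R by rewrite ln_gt0 // ltr1n.
have pX b : prob p X (X b) = 2^-1.
  rewrite (@eq_prob _ _ _ _ _ _ id _ b) ?prob_id // => c.
  by rewrite /X; case: b; case: c.
have entX : entr p X = ln 2.
  rewrite /entr big_bool !pX /mass /p /m /= lnV ?posrE //; lra.
have HE r : entr p (fun w => slope_proj r (X w) 0) =
    if r is Some _ then ln 2 else 0.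
  case: r => [r|]; last by rewrite /= entr_cst.
  by rewrite -entX; apply: entr_eq => w v _ _ /=; rewrite !mulr0 !addr0.
have half : 0 <= ln 2 / 2 :> R by lra.
have := adm _ p X (fun=> 0) (ln 2 / 2) (ln 2 / 2) ind half half.
rewrite HE => H; have {H} : ln 2 <= ln 2 / 2 + t * (ln 2 / 2).
  (* The entropy is [ln 2 = M + L] at finite slopes and [0 = M - L] at infinity. *)
  by apply: H => -[r|] _; rewrite HE; lra.
by nra.
Qed.

End Main.

(** * The exponents *)

Section Admissible.
Context (R : realType).
Local Open Scope classical_set_scope.
Local Open Scope ring_scope.

Lemma entr_le_bigmax (S : {fset slope}) (O : finType) (p : fdist R O)
    (U V : O -> rat) (F : slope -> R) :
  (forall r, F r = entr p (fun w => slope_proj r (U w) (V w))) ->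
  forall r, r \in S ->
  entr p (fun w => slope_proj r (U w) (V w)) <= \big[Num.max/0]_(r <- S) F r.
Proof. by move=> FE r rS; rewrite -FE; exact: le_bigmax_seq. Qed.

(** The trivial exponent, for the case of an infinite constant: slopes 0 and infinity bound the
    entropies of both coordinates. *)
Lemma SD_admissible_2 (S : {fset slope}) (s : slope) :
  slope_of 0 \in S -> slope_infty \in S -> @SD_admissible R S s 2.
Proof.
move=> S0 Soo d T P X Y fX fY.
have [W [p [U [V [_ E]]]]] := exists_fdist_of_pair P fX fY.
have le_M := entr_le_bigmax (S := S) E.
have leU : entr p U <= \big[Num.max/0]_(r <- S) entropy P (proj_rv r X Y).
  apply: le_trans (le_M _ S0); apply: entr_mono => w v _ _ /=.
  by rewrite !mul0r !addr0.
have leV := le_M _ Soo.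
rewrite E; apply: (@le_trans _ _ (entr p U + entr p V)).
  by apply: entr_subadd => w v _ _ [-> ->].
by rewrite mulrDl mul1r; apply: lerD.
Qed.

Lemma SD_admissible_indep (S : {fset slope}) (q : rat) (t : R) :
  slope_of 0 \in S -> slope_of 1 \in S -> slope_infty \in S ->
  indep_admissible S (slope_of q) t ->
  SD_admissible S (slope_of q) (2 - 26^-1 / t).
Proof.
move=> S0 S1 Soo /indep_admissible_finite adm d T P X Y fX fY.
have [W [p [U [V [inj E]]]]] := exists_fdist_of_pair P fX fY.
rewrite E.
apply: (finite_SD_bound inj S0 S1 Soo (finitely_admissible_ge1 adm) adm).
exact: entr_le_bigmax.
Qed.

Lemma indep_admissible_indep_sum_diff (S : {fset slope}) (s : slope) (t : R) :
  indep_sum_diff R S s = t%:E -> indep_admissible S s t.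
Proof.
move=> tE d T P X Y M K fX fY ind M0 K1 bnd.
have L0 : 0 <= ln K by exact: ln_ge0.
rewrite leNgt; apply/negP => lt_H.
set H := entropy _ _ in lt_H.
(* Raising [t] by [e] adds less than the excess; the [+ 1] covers [ln K = 0]. *)
pose e := (H - (M + t * ln K)) / (ln K + 1).
have e0 : 0 < e by rewrite divr_gt0 ?subr_gt0 //; lra.
have [_ [t' adm <-]] : exists2 y,
    [set u%:E | u in @indep_admissible R S s] y & (y < (t + e)%:E)%E.
  by apply: ereal_inf_lt; rewrite -/(indep_sum_diff R S s) tE lte_fin; lra.
rewrite lte_fin => lt_t'.
have := adm _ _ P X Y M K fX fY ind M0 K1 bnd; rewrite -/H.
have eE : e * (ln K + 1) = H - (M + t * ln K) by rewrite divfK // gt_eqF //; lra.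
have := ler_wpM2r L0 (ltW lt_t'); move: eE e0; rewrite mulrDr mulrDl mulr1; lra.
Qed.

End Admissible.

Local Open Scope ereal_scope.

(* Inversion on \bar R satisfies (+oo)^-1 = 0. *)
Theorem theorem3p2 (R : realType) :
  exists2 c : R, (0 < c)%R &
    forall (S : {fset slope}) (s : slope),
      slope_of 0%R \in S -> slope_of 1%R \in S -> slope_infty \in S ->
      s \notin S ->
      SD R S s <= 2%:E - c%:E / indep_sum_diff R S s.
Proof.
exists (26^-1)%R; first by rewrite invr_gt0.
(* Slope infinity lies in [S], so [s] is a rational [q]. *)
move=> S [q|] S0 S1 Soo sS; last by rewrite Soo in sS.
rewrite -/(slope_of q) in sS *.
move fE : (indep_sum_diff R S _) => f.
case: (pselect (exists t, @indep_admissible R S (slope_of q) t)) => [[t0 adm0]|none].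
  have f_le t : @indep_admissible R S (slope_of q) t -> f <= t%:E.
    by move=> adm; rewrite -fE; apply: ereal_inf_lbound; exists t.
  (* This excludes [-oo] and 0, and [t0] excludes [+oo], so the inverse of [f] is that of a positive
     real. *)
  have f1 : 1%:E <= f.
    rewrite -fE; apply: le_ereal_inf_tmp => _ [t adm <-]; rewrite lee_fin.
    exact: finitely_admissible_ge1 (indep_admissible_finite adm).
  have := f_le _ adm0; case: f fE f1 {f_le} => [t||] // fE; rewrite lee_fin => t1 _.
  have adm := indep_admissible_indep_sum_diff fE.
  rewrite inver gt_eqF; last by apply: lt_le_trans t1.
  rewrite -EFinM -EFinB; apply: ereal_inf_lbound.
  by exists (2 - 26^-1 / t)%R => //; exact: SD_admissible_indep.
have -> : f = +oo.
  rewrite -fE /indep_sum_diff (_ : [set _ | _ in _]%classic = set0) ?ereal_inf0 //.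
  by rewrite -subset0 => y [t adm _]; case: none; exists t.
rewrite invey mule0 sube0; apply: ereal_inf_lbound.
by exists 2%R => //; exact: SD_admissible_2.
Qed.
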